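(* Fix $z_0\in\mathbb{C}$. Let $\tilde X=(\tilde x_{ij})_{1\le i,j\le n}$ be chosen uniformly from the set of $n\times n$ doubly stochastic matrices with all entries at most $10\log n/n$. Let $\tilde X_{(n-1)\times n}$ be the $n\times n$ matrix obtained from $\tilde X$ by replacing its first row with the zero vector, and let $F_{z_0}$ be the $n\times n$ deterministic matrix whose first row is $(-\sqrt n,\dots,-\sqrt n)$, whose first column is $(-\sqrt n,0,\dots,0)^T$, and whose lower-right $(n-1)\times(n-1)$ block is $z_0I_{n-1}$. Then there exists a constant $A>0$ such that \[ \mathbb{P}\big(\sigma_n(\sqrt n\,\tilde X_{(n-1)\times n}-F_{z_0})\le n^{-A}\big)=O(n^{-3}), \] where $\sigma_n(\cdot)$ denotes the smallest singular value of an $n\times n$ matrix.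
   Context: A real $n\times n$ matrix is doubly stochastic if its entries are nonnegative and all row and column sums equal $1$. Such matrices are identified, via $X\mapsto(x_{ij})_{2\le i,j\le n}$, with points of $\mathbb{R}^{(n-1)^2}$; ''chosen uniformly'' from the given subset means according to normalized Lebesgue measure on its image. *)

(* Defs.v *)
From HB Require Import structures.
From mathcomp Require Import all_boot all_order all_algebra.
From mathcomp Require Import spectral complex.
From mathcomp Require Import all_classical all_reals all_analysis.

Set Implicit Arguments.
Unset Strict Implicit.
Unset Printing Implicit Defensive.

Import Order.TTheory GRing.Theory Num.Theory.
Import numFieldNormedType.Exports.

Local Open Scope classical_set_scope.
Local Open Scope ring_scope.
Local Open Scope sesquilinear_scope.
Local Open Scope complex_scope.

Section lebesgue_cons.
Context {R : realType} (n : nat).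
Local Notation RT := (measurableTypeR R).

Definition tcons (p : RT * n.-tuple RT) : n.+1.-tuple RT :=
  [tuple of p.1 :: p.2].

Lemma measurable_tcons : measurable_fun [set: RT * n.-tuple RT] tcons.
Proof. exact: measurable_cons. Qed.

Lemma tcons_uncons (t : n.+1.-tuple RT) :
  tcons (thead t, [tuple of behead t]) = t.
Proof. by apply: val_inj; rewrite [in RHS](tuple_eta t). Qed.

Lemma uncons_tcons (p : RT * n.-tuple RT) :
  (thead (tcons p), [tuple of behead (tcons p)]) = p.
Proof. by case: p => x t; rewrite theadE; congr pair; apply: val_inj. Qed.

Lemma measurable_uncons : measurable_fun [set: n.+1.-tuple RT]
  (fun t => (thead t, [tuple of behead t]) : RT * n.-tuple RT).
Proof.
apply/measurable_fun_pair; first exact: measurable_tnth.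
exact: measurable_behead.
Qed.

Variable mu : {sigma_finite_measure set (n.-tuple RT) -> \bar R}.

Definition lebesgue_cons : set (n.+1.-tuple RT) -> \bar R :=
  pushforward (lebesgue_measure \x mu)%E tcons.

Let mpre A : measurable A -> measurable (tcons @^-1` A).
Proof. by move=> mA; rewrite -[X in measurable X]setTI; exact: measurable_tcons. Qed.

Let lebesgue_cons0 : lebesgue_cons set0 = 0%E.
Proof. by rewrite /lebesgue_cons /pushforward preimage_set0 measure0. Qed.

Let lebesgue_cons_ge0 A : (0 <= lebesgue_cons A)%E.
Proof. by rewrite /lebesgue_cons /pushforward; apply: measure_ge0. Qed.

Let lebesgue_cons_sigma_additive : semi_sigma_additive lebesgue_cons.
Proof.
move=> F mF tF mUF; rewrite /lebesgue_cons /pushforward preimage_bigcup.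
apply: measure_semi_sigma_additive.
- by move=> k; exact: mpre.
- apply/trivIsetP => /= i j _ _ ij; rewrite -preimage_setI.
  by move/trivIsetP : tF => /(_ _ _ _ _ ij) ->//; rewrite preimage_set0.
- by rewrite -preimage_bigcup; exact: mpre.
Qed.

HB.instance Definition _ := isMeasure.Build _ _ _ lebesgue_cons
  lebesgue_cons0 lebesgue_cons_ge0 lebesgue_cons_sigma_additive.

Let lebesgue_cons_sigma_finite : sigma_finite setT lebesgue_cons.
Proof.
have /sigma_finiteP[F [TF ndF Foo]] := sigma_finiteT (@lebesgue_measure R).
have /sigma_finiteP[G [TG ndG Goo]] := sigma_finiteT mu.
pose unc (t : n.+1.-tuple RT) := (thead t, [tuple of behead t]).
exists (fun k => unc @^-1` (F k `*` G k)) => [|k].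
  apply/esym/seteqP; split => // t _.
  have : [set: RT] (thead t) by [].
  have : [set: n.-tuple RT] [tuple of behead t] by [].
  rewrite TF TG => -[j _ Gj] [k _ Fk]; exists (maxn k j) => //; split => /=.
    by move: Fk; exact/subsetPset/ndF/leq_maxl.
  by move: Gj; exact/subsetPset/ndG/leq_maxr.
have [mF Fk] := Foo k; have [mG Gk] := Goo k; split.
  rewrite -[X in measurable X]setTI; apply: measurable_uncons => //.
  exact: measurableX.
rewrite /lebesgue_cons /pushforward -comp_preimage.
rewrite (_ : unc \o tcons = id); last first.
  by apply/funext => p /=; exact: uncons_tcons.
by rewrite product_measure1E// lte_mul_pinfty// ge0_fin_numE.
Qed.

HB.instance Definition _ := Measure_isSigmaFinite.Build _ _ _ lebesgue_cons
  lebesgue_cons_sigma_finite.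

End lebesgue_cons.

Section lebesgue.
Context {R : realType}.
Local Notation RT := (measurableTypeR R).

(* Lebesgue measure on R^k, as an iterated product. *)
Fixpoint lebesgue_tuple (k : nat) :
    {sigma_finite_measure set (k.-tuple RT) -> \bar R} :=
  match k with
  | 0 => \d_([tuple] : 0.-tuple RT)
  | k'.+1 => lebesgue_cons (lebesgue_tuple k')
  end.

Lemma lebesgue_tuple_box k (B : 'I_k -> set RT) :
  (forall i, measurable (B i)) ->
  lebesgue_tuple k [set t | forall i, B i (tnth t i)] =
  (\prod_(i < k) lebesgue_measure (B i))%E.
Proof.
elim: k B => [|k IH] B mB /=.
  by rewrite big_ord0 diracE mem_set// => -[].
rewrite /lebesgue_cons /pushforward big_ord_recl -IH//.
rewrite -product_measure1E//; last first.
  rewrite (_ : [set t | _] =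
      \bigcap_(i in [set: 'I_k]) ((@tnth _ RT ^~ i) @^-1` B (lift ord0 i))).
    apply: fin_bigcap_measurable => // i _.
    by rewrite -[X in measurable X]setTI; exact: measurable_tnth.
  by apply/seteqP; split => [t /= h i _|t h i]; [exact: h|exact: (h i)].
congr (_ _); apply/seteqP; split => -[x t] /=.
  move=> h; split; first by have := h ord0; rewrite tnth0.
  by move=> i; have := h (lift ord0 i); rewrite tnthS.
move=> [h0 h] i; case: (unliftP ord0 i) => [j ->|->]; last by rewrite tnth0.
by rewrite tnthS.
Qed.

(* Lebesgue measure on R^(m * m), the coordinates being arranged as a matrix. *)
Definition lebesgue_mx (m : nat) (A : set 'M[R]_m) : \bar R :=
  lebesgue_tuple (m * m)
    [set t | A (vec_mx (\row_(i < m * m) tnth t i))].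

End lebesgue.

Section singular_values.
Context {R : realType} (n : nat).

(* The square roots of the eigenvalues of M^* M, in nonincreasing order and
   with multiplicity; spectral_diag lists the eigenvalues because M^* M is
   hermitian, and complex.Re only casts these nonnegative reals from R[i]
   to R. *)
Definition singular_values (M : 'M[R[i]]_n) : seq R :=
  sort (fun x y => y <= x)
    [seq Num.sqrt (complex.Re (spectral_diag (M ^t* *m M) 0 i)) | i : 'I_n].

Definition singular_value (k : nat) (M : 'M[R[i]]_n) : R :=
  nth 0 (singular_values M) k.-1.

End singular_values.

Section random_doubly_stochastic.
Context {R : realType}.

Definition doubly_stochastic (n : nat) (X : 'M[R]_n) : Prop :=
  [/\ forall i j, 0 <= X i j,
      forall i, \sum_(j < n) X i j = 1 &
      forall j, \sum_(i < n) X i j = 1].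

Definition capped_doubly_stochastic (n : nat) : set 'M[R]_n :=
  [set X | doubly_stochastic X /\
           forall i j, X i j <= 10 * ln n%:R / n%:R].

(* The point (x_ij)_{2 <= i, j <= n} of R^((n - 1)^2), with n = m + 1. *)
Definition minor_coordinates {m : nat} (X : 'M[R]_m.+1) : 'M[R]_m :=
  drsubmx (X : 'M[R]_(1 + m)).

(* The probability of E for X uniform on S, where S is identified with its
   image in R^(m * m). *)
Definition prob_uniform_on (m : nat) (S E : set 'M[R]_m.+1) : R :=
  fine (lebesgue_mx (minor_coordinates @` (S `&` E))) /
  fine (lebesgue_mx (minor_coordinates @` S)).

Definition zero_first_row (m : nat) (X : 'M[R]_m.+1) : 'M[R]_m.+1 :=
  \matrix_(i, j) if i == ord0 then 0 else X i j.

Definition shift_mx (m : nat) (z : R[i]) : 'M[R[i]]_m.+1 :=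
  let s : R[i] := (Num.sqrt m.+1%:R)%:C in
  block_mx (const_mx (- s) : 'M[R[i]]_1) (const_mx (- s) : 'M[R[i]]_(1, m))
           (0 : 'M[R[i]]_(m, 1))         (z%:M : 'M[R[i]]_m).

Definition shifted_mx (m : nat) (z : R[i]) (X : 'M[R]_m.+1) : 'M[R[i]]_m.+1 :=
  (Num.sqrt m.+1%:R)%:C *: map_mx (real_complex R) (zero_first_row X) - shift_mx m z.

End random_doubly_stochastic.

(* Main.v *)
Require Import Defs.
From mathcomp Require Import all_boot all_order all_algebra.
From mathcomp Require Import spectral complex.
From mathcomp Require Import all_classical all_reals all_analysis measurable_realfun.
From mathcomp Require Import ring lra.

(* Columns and rows are combined, using that the row sums of X are 1, to replace
   the matrix by B = sqrt n Y - z0 I - ((sqrt n - z0) / n) J with Y the minor of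
   X, whose entries are free coordinates. If the least singular value is at most
   e, some vector u with an entry of modulus at least 1 / (4 n) has |B u| = O(e),
   and Cramer's rule gives |det B| <= poly(n) e |cof_ij B| for some (i, j). As det B is affine
   in y_ij with slope sqrt n cof_ij, this confines y_ij to an interval of length
   poly(n) e once the other coordinates are fixed. In a convex body K of
   dimension d that contains a segment of length h in direction (i, j), such a
   thin set E has small proportion: contracting E by the ratio 1 - 1 / (2 d)
   towards N points of the segment gives N disjoint subsets of K, each of volume
   at least vol E / 2. Here h = 1 / n, the segment starts at the matrix J / n, and
   N = n ^ 6 beats the at most n ^ 3 thin sets when e = n ^ -17. *)

Set Implicit Arguments.
Unset Strict Implicit.
Unset Printing Implicit Defensive.

Import Order.TTheory GRing.Theory Num.Theory.
Import numFieldNormedType.Exports.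

Local Open Scope classical_set_scope.
Local Open Scope ring_scope.
Local Open Scope complex_scope.

(** * Scaling, translation and monotonicity of Lebesgue measure *)

Section lebesgue_affine.
Context {R : realType}.
Local Notation RT := (measurableTypeR R).
Local Notation mu := (@lebesgue_measure R).

Lemma integral_lebesgue_affine (a b : R) (f : RT -> \bar R) : 0 < a ->
  measurable_fun [set: RT] f -> (forall x, (0 <= f x)%E) ->
  (\int[mu]_x f x = a%:E * \int[mu]_x f (a * x + b)%R)%E.
Proof.
move=> a0 mf f0.
pose phi (x : RT) : RT := a * x + b.
have mphi : measurable_fun [set: RT] phi.
  by apply: measurable_funD => //; exact: measurable_funM.
pose phimu : {measure set RT -> \bar R} :=
  measure_function_pushforward__canonical__measure_function_Measure mu mphi.
pose nu := mscale (NngNum (ltW a0)) phimu.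
have munu (A : set RT) : measurable A -> mu A = nu A.
  move=> mA; apply: lebesgue_measure_unique => //= _ [[x y]] _ <-.
  rewrite /nu /mscale /= /pushforward.
  rewrite (_ : phi @^-1` _ = `](x - b) / a, (y - b) / a]%classic); last first.
    apply/seteqP; split => t /=; rewrite /phi !in_itv/= ltr_pdivrMr// ler_pdivlMr//;
      by rewrite ltrBlDr lerBrDr mulrC.
  rewrite [LHS]lebesgue_measure_itv [X in (_ * X)%E]lebesgue_measure_itv/= !lte_fin.
  rewrite ltr_pM2r ?invr_gt0// ltrD2r; case: ifPn => _; last by rewrite mule0.
  by rewrite -!EFinD -EFinM; congr EFin; field; rewrite gt_eqF.
rewrite (eq_measure_integral nu) => [|A mA _]; last exact: munu.
rewrite ge0_integral_mscale//=.
by congr (_ * _)%E; rewrite (ge0_integral_pushforward mphi)// preimage_setT.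
Qed.

Definition affine_tuple k (a : R) (b t : k.-tuple RT) : k.-tuple RT :=
  [tuple a * tnth t i + tnth b i | i < k].

Lemma measurable_affine_tuple k a b :
  measurable_fun [set: k.-tuple RT] (affine_tuple a b).
Proof.
apply/measurable_fun_tnthP => i.
rewrite (_ : _ \o _ = fun t : k.-tuple RT => a * tnth t i + tnth b i); last first.
  by apply/funext => t /=; rewrite tnth_mktuple.
apply: measurable_funD => //; apply: measurable_funM => //.
exact: measurable_tnth.
Qed.

(** Induction on the dimension: the first coordinate gives one factor [a] by the one-dimensional
    change of variables, its slices give the remaining ones. *)
Lemma lebesgue_tuple_affine k (a : R) (b : k.-tuple RT) A : 0 < a ->
  measurable A ->
  lebesgue_tuple k A = ((a ^+ k)%:E * lebesgue_tuple k (affine_tuple a b @^-1` A))%E.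
Proof.
move=> a0; elim: k b A => [|k IH] b A mA.
  rewrite expr0 mul1e /= !diracE; congr (_%:E); congr (nat_of_bool _)%:R.
  by apply/idP/idP; rewrite !inE /= [affine_tuple _ _ _]tuple0.
have mA' : measurable (@tcons R k @^-1` A).
  by rewrite -[X in measurable X]setTI; exact: measurable_tcons.
have mpre : measurable (affine_tuple a b @^-1` A).
  by rewrite -[X in measurable X]setTI; exact: measurable_affine_tuple.
have mpre' : measurable (@tcons R k @^-1` (affine_tuple a b @^-1` A)).
  by rewrite -[X in measurable X]setTI; exact: measurable_tcons.
rewrite /= /lebesgue_cons /pushforward /product_measure1.
rewrite (integral_lebesgue_affine (thead b) a0)//=; last first.
  exact: measurable_fun_xsection.
rewrite exprS EFinM -muleA; congr (_ * _)%E.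
rewrite -ge0_integralZl//; last 2 first.
  exact: measurable_fun_xsection.
  by rewrite lee_fin exprn_ge0// ltW.
apply: eq_integral => x _ /=.
rewrite (IH [tuple of behead b]); last exact: measurable_xsection.
congr (_ * lebesgue_tuple k _)%E; apply/seteqP.
suff e t : @tcons R k (a * x + thead b, affine_tuple a [tuple of behead b] t) =
    affine_tuple a b (@tcons R k (x, t)).
  by split=> t; rewrite /xsection /= !inE /= e.
apply/eq_from_tnth => i; rewrite tnth_mktuple; case: (unliftP ord0 i) => [j ->|->].
  by rewrite !tnthS tnth_mktuple [in RHS](tuple_eta b) tnthS.
by rewrite !tnth0 [in RHS](tuple_eta b) tnth0.
Qed.

Lemma ge0_le_integral_nonmeasurable d (T : measurableType d)
    (nu : {measure set T -> \bar R}) (f g : T -> \bar R) :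
  (forall x, 0 <= f x)%E -> (forall x, f x <= g x)%E ->
  (\int[nu]_x f x <= \int[nu]_x g x)%E.
Proof.
move=> f0 fg; have g0 x : (0 <= g x)%E by exact: le_trans (fg x).
rewrite !ge0_integralTE//; apply: le_ereal_sup => _ [h hf <-].
by exists h => // x; exact: le_trans (fg x).
Qed.

(* Monotonicity also on nonmeasurable sets: the integral defining the product
   measure is a supremum over simple functions from below. It spares a proof
   that the event on the least singular value is measurable. *)
Lemma lebesgue_tuple_le k (A B : set (k.-tuple RT)) : A `<=` B ->
  (lebesgue_tuple k A <= lebesgue_tuple k B)%E.
Proof.
elim: k A B => [|k IH] A B AB /=.
  rewrite !diracE lee_fin ler_nat; case: (boolP (_ \in A)) => //.
  by rewrite inE => /AB At; rewrite mem_set.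
rewrite /lebesgue_cons /pushforward /product_measure1.
apply: ge0_le_integral_nonmeasurable => x //=.
by apply: IH => t; rewrite /xsection /= !inE => /AB.
Qed.

End lebesgue_affine.

(** * Volume of sets that are thin in one coordinate direction *)

Lemma bernoulli_le (R : realFieldType) (x : R) k : 0 <= x <= 1 ->
  1 - k%:R * x <= (1 - x) ^+ k.
Proof.
move=> /andP[x0 x1]; elim: k => [|k IH]; first by rewrite mul0r subr0 expr0.
rewrite exprS; apply: (@le_trans _ _ ((1 - x) * (1 - k%:R * x))).
  rewrite -natr1; have : 0 <= k%:R * x * x by rewrite !mulr_ge0.
  lra.
by apply: ler_wpM2l => //; rewrite subr_ge0.
Qed.

Lemma natr_dist_ge1 (R : realDomainType) (i j : nat) : i != j ->
  1 <= `|i%:R - j%:R : R|.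
Proof.
wlog ij : i j / (i < j)%N => [hwlog|] ij'.
  move: ij'; rewrite neq_ltn => /orP[] ij.
    by apply: hwlog => //; rewrite ltn_eqF.
  by rewrite distrC; apply: hwlog => //; rewrite ltn_eqF.
rewrite distrC -natrB; last exact: ltnW.
by rewrite normr_nat ler1n subn_gt0.
Qed.

Section thin_sets.
Context {R : realType}.
Local Notation RT := (measurableTypeR R).

(* Contracting E slightly towards N points on a segment in direction p yields
   N sets that are pairwise disjoint, because E is thin in that direction, and
   remain inside K. *)
Lemma lebesgue_thin_set k (K E : set (k.-tuple RT)) (p : 'I_k) (c : 'I_k -> R)
    (h r : R) (N : nat) : measurable E -> E `<=` K -> 0 < h ->
  (forall (t : k.-tuple RT) (s l : R), K t -> 0 <= l <= 1 -> 0 <= s <= h ->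
     K [tuple (1 - l) * tnth t i + l * (c i + s *+ (i == p)) | i < k]) ->
  (forall t u : k.-tuple RT, E t -> E u ->
     (forall i, i != p -> tnth t i = tnth u i) ->
     `|tnth t p - tnth u p| <= r) ->
  2 * k%:R * N%:R * r < h ->
  (N%:R%:E * lebesgue_tuple k E <= 2%:E * lebesgue_tuple k K)%E.
Proof.
move=> mE EK h0 starK thinE rh.
case: (posnP N) => [->|N0]; first by rewrite mul0e mule_ge0.
have k1 : 1 <= k%:R :> R by rewrite ler1n; exact: leq_ltn_trans (ltn_ord p).
have k0 : 0 < k%:R :> R by rewrite (lt_le_trans _ k1).
have N0' : 0 < N%:R :> R by rewrite ltr0n.
(* With this [l], Bernoulli's inequality shows that a contraction by [1 - l] keeps at least half of
   the volume. *)
pose l : R := (2 * k%:R)^-1.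
have kl : k%:R * l = 2^-1 by rewrite /l; field; rewrite gt_eqF.
have l0 : 0 < l by rewrite invr_gt0 mulr_gt0.
have l2 : l <= 2^-1 by rewrite -kl ler_peMl// ltW.
pose a := 1 - l.
have a0 : 0 < a by rewrite /a; lra.
have a1 : a <= 1 by rewrite /a; lra.
have ak : 2^-1 <= a ^+ k.
  by apply: le_trans (bernoulli_le k _); rewrite ?kl; lra.
pose s (j : 'I_N) := h * (j%:R / N%:R).
have s_itv j : 0 <= s j <= h.
  apply/andP; split; first by rewrite !mulr_ge0// ?invr_ge0 ltW.
  by rewrite ger_pMr// ler_pdivrMr// mul1r ler_nat ltnW.
(* [F j] is the image of [E] under the contraction towards the point at height [s j] of the segment.
   It is written as a preimage under the inverse map, so that measurability is immediate. *)
pose b j : k.-tuple RT := [tuple - a^-1 * (l * (c i + s j *+ (i == p))) | i < k].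
pose F j := affine_tuple a^-1 (b j) @^-1` E.
have mF j : measurable (F j).
  by rewrite -[X in measurable X]setTI; exact: measurable_affine_tuple.
have muF j : lebesgue_tuple k (F j) = ((a ^+ k)%:E * lebesgue_tuple k E)%E.
  rewrite (@lebesgue_tuple_affine _ _ a^-1 (b j) E) ?invr_gt0// muleA -EFinM.
  by rewrite -exprMn divff ?gt_eqF// expr1n mul1e.
have FK j : F j `<=` K.
  move=> t /EK /starK /(_ _ (s_itv j)) Kt.
  have l01 : 0 <= l <= 1 by lra.
  move: (Kt l l01); congr K; apply: eq_from_tnth => i.
  by rewrite !tnth_mktuple -/a; field; rewrite gt_eqF.
have tF : trivIset [set: 'I_N] F.
  apply/trivIsetP => i j _ _ ij; apply/seteqP; split => // t [Fi Fj].
  (* A common point of [F i] and [F j] comes from two points of [E] that differ only in coordinate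
     [p], by at least [l * h / N = h / (2 k N) > r], against thinness. *)
  have dtn q : tnth (affine_tuple a^-1 (b i) t) q - tnth (affine_tuple a^-1 (b j) t) q
      = - a^-1 * (l * h) / N%:R * ((i%:R - j%:R) *+ (q == p)).
    rewrite !tnth_mktuple /s; case: (q == p); rewrite ?mulr1n ?mulr0n; field;
      by rewrite !gt_eqF.
  have := thinE _ _ Fi Fj; rewrite dtn eqxx mulr1n => H.
  have {}/H : forall q, q != p ->
      tnth (affine_tuple a^-1 (b i) t) q = tnth (affine_tuple a^-1 (b j) t) q.
    by move=> q /negbTE qp; apply/eqP; rewrite -subr_eq0 dtn qp mulr0n mulr0.
  apply/negP; rewrite -ltNge normrM.
  have x0 : 0 < a^-1 * (l * h) / N%:R by rewrite divr_gt0// mulr_gt0 ?invr_gt0// mulr_gt0.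
  rewrite !mulNr normrN (gtr0_norm x0).
  apply: (@lt_le_trans _ _ (a^-1 * (l * h) / N%:R)).
    apply: (@lt_le_trans _ _ (l * h / N%:R)).
      rewrite ltr_pdivlMr// /l mulrC -ltr_pdivrMl ?invr_gt0 ?mulr_gt0// invrK.
      by rewrite mulrA.
    rewrite ler_pM2r ?invr_gt0// ler_peMl//; first by rewrite mulr_ge0// ltW.
    by rewrite invf_ge1.
  by rewrite ler_peMr ?(ltW x0)// natr_dist_ge1.
have leK : (\sum_(j < N) lebesgue_tuple k (F j) <= lebesgue_tuple k K)%E.
  rewrite -measure_bigsetU_ord//; apply: lebesgue_tuple_le.
  by apply: (big_ind (fun A => A `<=` K)) => // A B AK BK t [/AK|/BK].
apply: (@le_trans _ _ (2%:E * \sum_(j < N) lebesgue_tuple k (F j))%E); last first.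
  by apply: lee_wpmul2l => //; rewrite lee_fin.
under eq_bigr do rewrite muF.
rewrite -ge0_sume_distrl; last by move=> j _; rewrite lee_fin exprn_ge0 ?ltW.
rewrite sumEFin sumr_const card_ord muleA -EFinM.
apply: lee_wpmul2r; first exact: measure_ge0.
by rewrite lee_fin -[a ^+ k *+ N]mulr_natl mulrCA ler_peMr ?ler0n//; lra.
Qed.

End thin_sets.

(** * Least singular value and reduction to the minor *)

Section linear_algebra.
Context {R : realType}.
Local Notation C := R[i].
Local Open Scope sesquilinear_scope.

(** Take for [w] a unit eigenvector of [M ^t* *m M], a column of [P ^t*]: the squared norm of
    [M *m w] is its eigenvalue, which dominates every squared entry. *)
Lemma singular_value_vector m (M : 'M[C]_m.+1) (e : R) : 0 <= e ->
  singular_value m.+1 M <= e ->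
  exists2 w : 'cV[C]_m.+1, \sum_k `|w k 0| ^+ 2 = 1 &
    forall k, `|(M *m w) k 0| <= e%:C.
Proof.
move=> e0; rewrite /singular_value /singular_values.
set H := M ^t* *m M; set s := sort _ _.
(* The index lies within the list, so [nth] returns the square root of some eigenvalue and not its
   default 0. *)
have /mem_nth : (m.+1.-1 < size s)%N by rewrite size_sort size_map size_enum_ord.
move=> /(_ 0); rewrite {2}/s mem_sort => /mapP[i _ ->].
have Hherm : H ^t* = H by rewrite /H trmx_mul map_mxM trmxCK.
have /orthomx_spectralP : H \is normalmx by apply/normalmxP; rewrite Hherm.
set P := spectralmx H; set D := spectral_diag H => HE.
have Pu : P *m P ^t* = 1%:M by exact/unitarymxP/spectral_unitarymx.
pose W := M *m P ^t*.
have WD : W ^t* *m W = diag_mx D.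
  rewrite /W trmx_mul map_mxM trmxCK !mulmxA -(mulmxA P) -/H HE !mulmxA.
  rewrite mulmxV ?spectral_unit// mul1mx -mulmxA Pu mulmx1.
  by [].
have Dsum : D 0 i = \sum_k `|W k i| ^+ 2.
  have := congr1 (fun A : 'M[C]_m.+1 => A i i) WD; rewrite !mxE eqxx mulr1n => <-.
  by apply: eq_bigr => k _; rewrite !mxE normCK mulrC.
have D0 : 0 <= D 0 i by rewrite Dsum sumr_ge0// => k _; rewrite exprn_ge0.
move=> De; exists (col i (P ^t*)).
  have := congr1 (fun A : 'M[C]_m.+1 => A i i) Pu; rewrite !mxE eqxx mulr1n => <-.
  by apply: eq_bigr => k _; rewrite !mxE normCK conjCK mulrC.
have -> : M *m col i (P ^t*) = col i W by rewrite /W !colE mulmxA.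
move=> k; rewrite mxE.
have eC : 0 <= e%:C by rewrite ler0c.
rewrite -(@ler_pXn2r _ 2)// ?nnegrE//; apply: (@le_trans _ _ (D 0 i)).
  by rewrite Dsum (bigD1 k)//= lerDl sumr_ge0// => j _; rewrite exprn_ge0.
rewrite -(RRe_real (ger0_real D0)) -rmorphXn lecR.
have ReD0 : 0 <= complex.Re (D 0 i) by rewrite -lecR (RRe_real (ger0_real D0)).
by rewrite -[leLHS]sqr_sqrtr// ler_pXn2r// nnegrE sqrtr_ge0.
Qed.

(** As this row is constant, a small [shifted_mx z X *m w] forces the entries of [w] to have a small
    sum. *)
Lemma shifted_mx0 m (z : C) (X : 'M[R]_m.+1) j :
  shifted_mx z X 0 j = (Num.sqrt m.+1%:R)%:C.
Proof.
rewrite !mxE mulr0 sub0r; case: splitP => [a _|//]; rewrite mxE.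
by case: splitP => b _; rewrite mxE opprK.
Qed.

Lemma shifted_mx_lift0 m (z : C) (X : 'M[R]_m.+1) i :
  shifted_mx z X (lift ord0 i) 0 =
  (Num.sqrt m.+1%:R)%:C * (X (lift ord0 i) 0)%:C.
Proof.
rewrite -!rshift1 !mxE (unsplitK (inr i)) mxE !rshift1.
by case: splitP => // b _; rewrite mxE subr0.
Qed.

Lemma shifted_mx_lift m (z : C) (X : 'M[R]_m.+1) i j :
  shifted_mx z X (lift ord0 i) (lift ord0 j) =
  (Num.sqrt m.+1%:R)%:C * (X (lift ord0 i) (lift ord0 j))%:C - z *+ (i == j).
Proof.
rewrite -!rshift1 !mxE (unsplitK (inr i)) mxE (unsplitK (inr j)) mxE.
by rewrite !rshift1.
Qed.

(* Up to bounded invertible row and column operations, which use that the row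
   sums of X are 1, [shifted_mx z X] is this matrix bordered by a multiple of
   a unit vector; unlike [shifted_mx z X], it depends affinely and entrywise on
   the minor Y of X. *)
Definition reduced_mx m (z : C) (Y : 'M[R]_m) : 'M[C]_m :=
  \matrix_(i, j) ((Num.sqrt m.+1%:R)%:C * (Y i j)%:C - z *+ (i == j)
                  - ((Num.sqrt m.+1%:R)%:C - z) / m.+1%:R).

(** Subtracting [x_i0] times the first row eliminates [w 0 0]; replacing the remaining [x_i0] by one
    minus the rest of its row turns each [w_j] into [w_j + S], up to the term [(s - z) * S]. *)
Lemma mul_reduced_mx m (z : C) (X : 'M[R]_m.+1) (w : 'cV[C]_m.+1) i :
  (forall i, \sum_j X i j = 1) ->
  (reduced_mx z (minor_coordinates X) *m
     \col_k (w (lift ord0 k) 0 + \sum_j w (lift ord0 j) 0)) i 0 =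
  (shifted_mx z X *m w) (lift ord0 i) 0
  - (X (lift ord0 i) 0)%:C * (shifted_mx z X *m w) 0 0.
Proof.
move=> X1; pose s : C := (Num.sqrt m.+1%:R)%:C; set S := \sum_j w (lift ord0 j) 0.
have Xi : \sum_j (X (lift ord0 i) (lift ord0 j))%:C = 1 - (X (lift ord0 i) 0)%:C.
  by rewrite -(raddf_sum (real_complex R))/= -(rmorph1 (real_complex R)) -(X1 (lift ord0 i))
    big_ord_recl rmorphD addrC addKr.
rewrite ![(shifted_mx _ _ *m _) _ _]mxE !big_ord_recl shifted_mx_lift0 shifted_mx0 -/s.
under [in X in _ - _ * X]eq_bigr do rewrite shifted_mx0 -/s.
rewrite -mulr_sumr -/S.
under [X in _ + X - _]eq_bigr do rewrite shifted_mx_lift -/s mulrBl -mulrA.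
rewrite sumrB -mulr_sumr.
have -> : \sum_j z *+ (i == j) * w (lift ord0 j) 0 = z * w (lift ord0 i) 0.
  rewrite (bigD1 i)//= eqxx mulr1n big1 ?addr0// => j ji.
  by rewrite eq_sym (negbTE ji) mulr0n mul0r.
rewrite mxE; pose q : C := (s - z) / m.+1%:R.
pose u j := w (lift ord0 j) 0 + S.
pose x j := (X (lift ord0 i) (lift ord0 j))%:C.
transitivity (\sum_j (s * (x j * w (lift ord0 j) 0) + s * S * x j
    - z *+ (i == j) * u j - q * (w (lift ord0 j) 0 + S))).
  apply: eq_bigr => j _; rewrite /reduced_mx /minor_coordinates !mxE !rshift1.
  by rewrite -/s -/S -/q -/(x j) /u; ring.
rewrite !sumrB big_split/= -!mulr_sumr big_split/= -/S Xi sumr_const card_ord.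
have -> : \sum_j z *+ (i == j) * u j = z * u i.
  rewrite (bigD1 i)//= eqxx mulr1n big1 ?addr0// => j ji.
  by rewrite eq_sym (negbTE ji) mulr0n mul0r.
(* The [m] numbers [w_j + S] add up to [(m + 1) * S]; hence the denominator [m.+1] in
   [reduced_mx]. *)
have -> : q * (S + S *+ m) = (s - z) * S.
  by rewrite -mulrS -[S *+ _]mulr_natl mulrA /q divfK// pnatr_eq0.
by rewrite /u /x; ring.
Qed.

End linear_algebra.

(** * Cramer's rule and determinants that are small relative to a cofactor *)

Section small_pivots.
Context {R : realType}.
Local Notation C := R[i].

(** Otherwise all [w_k + S] are at most [e] in modulus. They add up to [n * S], so [S] is at most
    [e] too, every entry of [w] is at most [2 e], and the squared norm of [w] is at most
    [4 n e ^ 2 = e < 1]. *)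
Lemma large_coordinate m (w : 'cV[C]_m.+1) (e : C) : e = (4 * m.+1%:R)^-1 ->
  \sum_k `|w k 0| ^+ 2 = 1 -> `|\sum_k w k 0| <= e ->
  exists k, e <= `|w (lift ord0 k) 0 + \sum_j w (lift ord0 j) 0|.
Proof.
move=> eE w1 we; set S := \sum_j w _ _.
have n0 : 0 < m.+1%:R :> C by rewrite ltr0n.
have ne : m.+1%:R * e = 4^-1.
  by rewrite eE invfM mulrCA divff ?mulr1// gt_eqF.
have e0 : 0 < e by rewrite eE invr_gt0 mulr_gt0// ltr0n.
apply: contrapT => /forallNP /= small.
have {}small k : `|w (lift ord0 k) 0 + S| <= e.
  by apply: ltW; rewrite real_ltNge ?realE ?(ltW e0) ?normr_ge0//; exact/negP/small.
have Se : `|S| <= e.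
  have : `|m.+1%:R * S| <= m.+1%:R * e.
    have -> : m.+1%:R * S = \sum_k (w (lift ord0 k) 0 + S).
      by rewrite big_split/= sumr_const card_ord -mulrS -[RHS]mulr_natl.
    apply: (@le_trans _ _ (m%:R * e)); last by rewrite ler_pM2r// ler_nat.
    apply: le_trans (ler_norm_sum _ _ _) _.
    rewrite mulr_natl -[in leRHS](card_ord m) -sumr_const.
    by apply: ler_sum => k _; exact: small.
  by rewrite normrM normr_nat ler_pM2l.
have w2e k : `|w k 0| <= e + e.
  case: (unliftP ord0 k) => [j ->|->].
    by rewrite -[w _ _](addrK S) (le_trans (ler_normB _ _))// lerD.
  have -> : w 0 0 = \sum_k w k 0 - S by rewrite big_ord_recl addrK.
  by rewrite (le_trans (ler_normB _ _))// lerD.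
suff : \sum_k `|w k 0| ^+ 2 <= e.
  rewrite w1; apply/negP; rewrite -real_ltNge ?realE ?ler01 ?(ltW e0)//.
  rewrite eE invf_lt1 ?mulr_gt0 ?ltr0n// -natrM ltr1n.
  by rewrite mulnS.
apply: (@le_trans _ _ (\sum_(k < m.+1) (e + e) ^+ 2)).
  by apply: ler_sum => k _; rewrite ler_pXn2r ?nnegrE// addr_ge0// ltW.
rewrite sumr_const card_ord -[_ *+ m.+1]mulr_natl.
have -> : m.+1%:R * (e + e) ^+ 2 = (m.+1%:R * e) * 4 * e by ring.
by rewrite ne mulVf ?mul1r// pnatr_eq0.
Qed.

(** Cramer's rule writes [\det B * u k 0] as a sum of [m] terms [cofactor B i k * (B *m u) i 0], and
    some term is at least the average in modulus. *)
Lemma cramer_bound m (B : 'M[C]_m) (u : 'cV[C]_m) (d e : C) k : 0 < e ->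
  (forall i, `|(B *m u) i 0| <= d) -> e <= `|u k 0| ->
  exists i, `|\det B| <= m%:R * d / e * `|cofactor B i k|.
Proof.
move=> e0 Bd eu.
have d0 : 0 <= d by apply: le_trans (Bd k).
have m0 : 0 < m%:R :> C by rewrite ltr0n; exact: leq_ltn_trans (ltn_ord k).
apply: contrapT => /forallNP /= big.
have {}big i : m%:R * d / e * `|cofactor B i k| < `|\det B|.
  rewrite real_ltNge ?realE ?normr_ge0//; first exact/negP/big.
  by rewrite !mulr_ge0// ?invr_ge0 ltW.
have : `|\det B| * e <= \sum_i d * `|cofactor B i k|.
  apply: (@le_trans _ _ `|\det B * u k 0|).
    by rewrite normrM ler_wpM2l.
  have -> : \det B * u k 0 = \sum_i cofactor B i k * (B *m u) i 0.
    have := congr1 (fun v : 'cV[C]_m => v k 0) (mulmxA (\adj B) B u).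
    rewrite mul_adj_mx mul_scalar_mx mxE [RHS]mxE => <-.
    by apply: eq_bigr => i _; rewrite mxE.
  apply: le_trans (ler_norm_sum _ _ _) _; apply: ler_sum => i _.
  by rewrite normrM mulrC ler_wpM2r.
apply/negP; rewrite -real_ltNge ?realE ?mulr_ge0 ?(ltW e0)//; last first.
  by rewrite sumr_ge0// => i _; rewrite mulr_ge0.
have : \sum_i m%:R * d / e * `|cofactor B i k| < \sum_(i < m) `|\det B|.
  by apply: ltr_sum => [|i _]; [apply/hasP; exists k => //; exact: mem_index_enum|].
rewrite sumr_const card_ord -[X in _ < X]mulr_natl.
rewrite -mulr_sumr -[_ / e * _]mulrA -[m%:R * d * _]mulrA ltr_pM2l// mulrCA.
by rewrite ltr_pdivrMl// [e * _]mulrC mulr_sumr.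
Qed.

(** Padding by the identity keeps the size [m] for all [k], while the determinant is that of the
    upper left block of size [k]. *)
Definition leading_block (F : nzRingType) m k (B : 'M[F]_m) : 'M[F]_m :=
  \matrix_(i, j) if (i < k)%N && (j < k)%N then B i j else (i == j)%:R.

Lemma leading_block_full (F : nzRingType) m (B : 'M[F]_m) : leading_block m B = B.
Proof. by apply/matrixP => i j; rewrite mxE !ltn_ord. Qed.

Lemma eq_cofactor (F : comNzRingType) m (A B : 'M[F]_m) i j :
  (forall a b, a != i -> b != j -> A a b = B a b) -> cofactor A i j = cofactor B i j.
Proof.
move=> AB; rewrite /cofactor; congr (_ * \det _); apply/matrixP => a b.
by rewrite !mxE AB// eq_sym neq_lift.
Qed.

(** Row [k] of [leading_block k B] is a unit vector, and the two blocks differ only in row and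
    column [k], which this cofactor does not see. *)
Lemma cofactor_leading_block (F : comNzRingType) m (B : 'M[F]_m) (k : 'I_m) :
  cofactor (leading_block k.+1 B) k k = \det (leading_block k B).
Proof.
rewrite (expand_det_row _ k) (bigD1 k)//= mxE ltnn eqxx mul1r.
rewrite big1 ?addr0 => [|j jk]; last by rewrite mxE ltnn eq_sym (negbTE jk) mul0r.
have ltk (a : 'I_m) : a != k -> (a < k.+1)%N = (a < k)%N.
  by move=> /negbTE ak; rewrite ltnS leq_eqVlt val_eqE ak.
by apply: eq_cofactor => a b ak bk; rewrite !mxE !ltk.
Qed.

(* The leading blocks of size k < m only serve when [\det B = 0]: taking k
   minimal with a singular leading block, its (k, k) cofactor, the determinant
   of the previous block, is nonzero. *)
Definition small_pivot m (c : R) (k : nat) (i j : 'I_m) (B : 'M[C]_m) : bool :=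
  let A := leading_block k B in
  [&& (i < k)%N, (j < k)%N, cofactor A i j != 0 &
      `|\det A| <= c%:C * `|cofactor A i j|].

Lemma small_pivot_exists m (c : R) (i j : 'I_m) (B : 'M[C]_m) : 0 <= c ->
  `|\det B| <= c%:C * `|cofactor B i j| ->
  exists p : 'I_m.+1 * 'I_m * 'I_m, small_pivot c p.1.1 p.1.2 p.2 B.
Proof.
move=> c0 detB.
have [B0|B0] := eqVneq (\det B) 0; last first.
  exists (ord_max, i, j) => /=; rewrite /small_pivot/= !ltn_ord leading_block_full.
  rewrite detB andbT/=; apply: contraNneq B0 => cof0.
  by move: detB; rewrite cof0 normr0 mulr0 normr_le0.
have ex : exists k, \det (leading_block k B) == 0.
  by exists m; rewrite leading_block_full B0.
(* The block of size 0 is the identity, so the minimal size is a successor. *)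
case: (ex_minnP ex) => -[|k] /eqP detk kmin.
  move: detk; rewrite (_ : leading_block _ _ = 1%:M) ?det1 => [/eqP|].
    by rewrite oner_eq0.
  by apply/matrixP => a b; rewrite !mxE.
have km : (k < m)%N by rewrite kmin// leading_block_full B0.
exists (lift ord0 (Ordinal km), Ordinal km, Ordinal km).
apply/and4P; split; rewrite /= ?lift0//; last first.
  by rewrite detk normr0 mulr_ge0// ler0c.
rewrite -[k in leading_block k.+1]/(val (Ordinal km)) cofactor_leading_block/=.
by apply/negP => /kmin; rewrite ltnn.
Qed.

Lemma det_pivot (F : comNzRingType) m (A B : 'M[F]_m) i j :
  (forall a b, (a, b) != (i, j) -> A a b = B a b) ->
  \det A - \det B = (A i j - B i j) * cofactor A i j.
Proof.
move=> AB; rewrite !(expand_det_row _ i) -sumrB (bigD1 j)//= big1 ?addr0.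
  rewrite mulrBl; congr (_ - _ * _); apply: eq_cofactor => a b ai _.
  by rewrite AB// xpair_eqE (negbTE ai).
move=> b bj; rewrite AB ?xpair_eqE ?(negbTE bj) ?andbF//.
rewrite (@eq_cofactor _ _ A B) ?subrr// => a b' ai _.
by rewrite AB// xpair_eqE (negbTE ai).
Qed.

(** The (i, j) cofactor is the same for both matrices, and the two determinants differ by
    [sqrt n * (Y i j - Z i j)] times it. Divide by this nonzero cofactor and use [sqrt n >= 1]. *)
Lemma small_pivot_thin m (z : C) (c : R) k (i j : 'I_m) (Y Z : 'M[R]_m) :
  (forall a b, (a, b) != (i, j) -> Y a b = Z a b) ->
  small_pivot c k i j (reduced_mx z Y) -> small_pivot c k i j (reduced_mx z Z) ->
  `|Y i j - Z i j| <= 2 * c.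
Proof.
move=> YZ /and4P[ik jk cof0 smallY] /and4P[_ _ _].
set A := leading_block k (reduced_mx z Y) in cof0 smallY.
set B := leading_block k (reduced_mx z Z).
have AB a b : (a, b) != (i, j) -> A a b = B a b.
  by move=> /YZ e; rewrite !mxE e.
rewrite -(@eq_cofactor _ _ A B) => [smallZ|a b ai _]; last first.
  by rewrite AB// xpair_eqE (negbTE ai).
have /(congr1 Num.norm) := det_pivot AB; rewrite normrM => detAB.
have : `|A i j - B i j| <= (2 * c)%:C.
  rewrite -(@ler_pM2r _ `|cofactor A i j|) ?normr_gt0// -detAB.
  rewrite (le_trans (ler_normB _ _))// rmorphM rmorph_nat mulr_natl mulrnAl mulr2n.
  by rewrite lerD.
rewrite !mxE ik jk/=.
set s := (Num.sqrt _)%:C; set q := _ / _; set y := (Y i j)%:C; set y' := (Z i j)%:C.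
have -> : s * y - z *+ (i == j) - q - (s * y' - z *+ (i == j) - q) = s * (y - y') by ring.
rewrite -rmorphB -rmorphM normc_def/= expr0n addr0 sqrtr_sqr lecR normrM.
apply: le_trans; rewrite ler_peMl// ger0_norm ?sqrtr_ge0//.
by rewrite -[leLHS]sqrtr1 ler_sqrt// ler1n.
Qed.

Lemma small_singular_value_pivot m (z : C) (e : R) (X : 'M[R]_m.+1) :
  (forall i, \sum_j X i j = 1) -> (forall i j, 0 <= X i j <= 1) ->
  0 <= e <= (4 * m.+1%:R)^-1 ->
  singular_value m.+1 (shifted_mx z X) <= e ->
  exists p : 'I_m.+1 * 'I_m * 'I_m,
    small_pivot (8 * m%:R * m.+1%:R * e) p.1.1 p.1.2 p.2
      (reduced_mx z (minor_coordinates X)).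
Proof.
move=> X1 X01 /andP[e0 en] /(singular_value_vector e0)[w w1 Mw].
pose h : C := (4 * m.+1%:R)^-1.
have hE : h = ((4 * m.+1%:R)^-1 : R)%:C by rewrite fmorphV rmorphM/= !rmorph_nat.
have h0 : 0 < h by rewrite invr_gt0 mulr_gt0 ?ltr0n.
have [k hk] : exists k, h <= `|w (lift ord0 k) 0 + \sum_j w (lift ord0 j) 0|.
  (* Entry 0 of [M w] is [sqrt n] times the sum of the entries of [w], and [sqrt n >= 1]. *)
  apply: large_coordinate => //; apply: (@le_trans _ _ e%:C); last by rewrite hE lecR.
  apply: le_trans (Mw 0); rewrite mxE.
  under [in leRHS]eq_bigr do rewrite shifted_mx0.
  rewrite -mulr_sumr normrM ler_peMl// ger0_norm ?ler0c ?sqrtr_ge0//.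
  by rewrite -(rmorph1 (real_complex R)) lecR -[leLHS]sqrtr1 ler_sqrt// ler1n.
pose u : 'cV[C]_m := \col_k (w (lift ord0 k) 0 + \sum_j w (lift ord0 j) 0).
(* The bound [2 e] adds the two terms of [mul_reduced_mx], as [x_i0 <= 1]. With [h = 1 / (4 n)] this
   gives [m * 2 e / h = 8 m n e]. *)
have [] := @cramer_bound _ (reduced_mx z (minor_coordinates X)) u (2 * e%:C) h k h0.
- move=> i; rewrite mul_reduced_mx// (le_trans (ler_normB _ _))//.
  rewrite mulr_natl mulr2n lerD// normrM -[leRHS]mul1r ler_pM//.
  have /andP[Xi0 Xi1] := X01 (lift ord0 i) 0.
  by rewrite ger0_norm ?ler0c// -(rmorph1 (real_complex R)) lecR.
- by rewrite mxE.
move=> i det_le; apply: (@small_pivot_exists _ _ i k); first by rewrite !mulr_ge0.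
apply: le_trans det_le _; apply: ler_wpM2r => //.
rewrite /h invrK !rmorphM/= !rmorph_nat; rewrite le_eqVlt; apply/orP; left; apply/eqP; ring.
Qed.

End small_pivots.

(** * Measurability of complex determinants and cofactors *)

Section complex_measurability.
Context {R : realType} d (T : measurableType d).
Local Notation C := R[i].

Definition measurable_complex (f : T -> C) :=
  measurable_fun [set: T] (fun t => complex.Re (f t)) /\
  measurable_fun [set: T] (fun t => complex.Im (f t)).

Lemma measurable_complex_cst (c : C) : measurable_complex (fun=> c).
Proof. by split; exact: measurable_cst. Qed.

Lemma measurable_complex_real (f : T -> R) : measurable_fun [set: T] f ->
  measurable_complex (fun t => (f t)%:C).
Proof. by move=> mf; split=> //; exact: measurable_cst. Qed.

Lemma measurable_complexD (f g : T -> C) : measurable_complex f ->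
  measurable_complex g -> measurable_complex (fun t => f t + g t).
Proof.
move=> [fr fi] [gr gi]; split.
  rewrite (_ : (fun _ => _) = (fun t => complex.Re (f t) + complex.Re (g t))).
    exact: measurable_funD.
  by apply/funext => t; case: (f t) => ? ?; case: (g t).
rewrite (_ : (fun _ => _) = (fun t => complex.Im (f t) + complex.Im (g t))).
  exact: measurable_funD.
by apply/funext => t; case: (f t) => ? ?; case: (g t).
Qed.

Lemma measurable_complexM (f g : T -> C) : measurable_complex f ->
  measurable_complex g -> measurable_complex (fun t => f t * g t).
Proof.
move=> [fr fi] [gr gi]; split.
  rewrite (_ : (fun _ => _) = (fun t => complex.Re (f t) * complex.Re (g t)
      - complex.Im (f t) * complex.Im (g t))).
    by apply: measurable_funB; exact: measurable_funM.
  by apply/funext => t; case: (f t) => ? ?; case: (g t).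
rewrite (_ : (fun _ => _) = (fun t => complex.Re (f t) * complex.Im (g t)
    + complex.Im (f t) * complex.Re (g t))).
  by apply: measurable_funD; exact: measurable_funM.
by apply/funext => t; case: (f t) => ? ?; case: (g t).
Qed.

Lemma measurable_complex_sum I (s : seq I) (f : I -> T -> C) :
  (forall i, measurable_complex (f i)) ->
  measurable_complex (fun t => \sum_(i <- s) f i t).
Proof.
move=> mf; elim: s => [|i s IH].
  by under eq_fun do rewrite big_nil; exact: measurable_complex_cst.
by under eq_fun do rewrite big_cons; exact: measurable_complexD.
Qed.

Lemma measurable_complex_prod I (s : seq I) (f : I -> T -> C) :
  (forall i, measurable_complex (f i)) ->
  measurable_complex (fun t => \prod_(i <- s) f i t).
Proof.
move=> mf; elim: s => [|i s IH].
  by under eq_fun do rewrite big_nil; exact: measurable_complex_cst.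
by under eq_fun do rewrite big_cons; exact: measurable_complexM.
Qed.

Lemma measurable_complex_det n (A : T -> 'M[C]_n) :
  (forall i j, measurable_complex (fun t => A t i j)) ->
  measurable_complex (fun t => \det (A t)).
Proof.
move=> mA; apply: measurable_complex_sum => s.
by apply: measurable_complexM; [exact: measurable_complex_cst|exact: measurable_complex_prod].
Qed.

Lemma measurable_complex_cofactor n (A : T -> 'M[C]_n) i j :
  (forall i j, measurable_complex (fun t => A t i j)) ->
  measurable_complex (fun t => cofactor (A t) i j).
Proof.
move=> mA; apply: measurable_complexM; first exact: measurable_complex_cst.
by apply: measurable_complex_det => a b; under eq_fun do rewrite !mxE.
Qed.

Lemma measurable_le_set (f g : T -> R) : measurable_fun [set: T] f ->
  measurable_fun [set: T] g -> measurable [set t | f t <= g t].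
Proof.
move=> mf mg; rewrite -[X in measurable X]setTI.
by apply: (measurable_fun_ler mf mg) => //; exact: measurable_set1.
Qed.

Lemma measurable_normc_le (c : R) (f g : T -> C) : measurable_complex f ->
  measurable_complex g -> measurable [set t | `|f t| <= c%:C * `|g t|].
Proof.
have mnorm h : measurable_complex h ->
    measurable_fun [set: T] (fun t => Num.sqrt (complex.Re (h t) ^+ 2 + complex.Im (h t) ^+ 2)).
  move=> [hr hi].
  apply: (measurableT_comp (continuous_measurable_fun (@sqrt_continuous R))).
  by apply: measurable_funD; exact: measurable_funX.
move=> mf mg; under eq_set do rewrite !normc_def -rmorphM lecR.
apply: measurable_le_set; first exact: mnorm.
by apply: measurable_funM; [exact: measurable_cst|exact: mnorm].
Qed.

End complex_measurability.

(** * The minor as a coordinate system on doubly stochastic matrices *)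

Section minor_space.
Context {R : realType}.
Local Notation RT := (measurableTypeR R).

Definition mx_of_tuple m (t : (m * m).-tuple RT) : 'M[R]_m :=
  vec_mx (\row_i tnth t i).

Lemma mx_of_tupleE m (t : (m * m).-tuple RT) i j :
  mx_of_tuple t i j = tnth t (mxvec_index i j).
Proof. by rewrite !mxE. Qed.

Lemma measurable_mx_of_tuple m i j :
  measurable_fun [set: (m * m).-tuple RT] (fun t => mx_of_tuple t i j).
Proof. by under eq_fun do rewrite mx_of_tupleE; exact: measurable_tnth. Qed.

Lemma measurable_small_pivot m (z : R[i]) (c : R) k (i j : 'I_m) :
  measurable [set t : (m * m).-tuple RT |
    small_pivot c k i j (reduced_mx z (mx_of_tuple t))].
Proof.
pose A (t : (m * m).-tuple RT) := leading_block k (reduced_mx z (mx_of_tuple t)).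
have mA a b : measurable_complex (fun t => A t a b).
  under eq_fun do rewrite /A mxE.
  case: ((a < k)%N && (b < k)%N); last exact: measurable_complex_cst.
  under eq_fun do rewrite mxE.
  apply: measurable_complexD; last exact: measurable_complex_cst.
  apply: measurable_complexD; last exact: measurable_complex_cst.
  apply: measurable_complexM; first exact: measurable_complex_cst.
  by apply: measurable_complex_real; exact: measurable_mx_of_tuple.
have mdet := measurable_complex_det mA.
have mcof := measurable_complex_cofactor i j mA.
have [/andP[ik jk]|ijk] := boolP ((i < k)%N && (j < k)%N); last first.
  rewrite (_ : [set t | _] = set0) => [|]; first exact: measurable0.
  by apply/seteqP; split => t //=; rewrite /small_pivot andbA (negbTE ijk).
(* A nonzero cofactor is expressed as the failure of a norm inequality with constant 0, so that
   [measurable_normc_le] covers both conditions. *)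
rewrite (_ : [set t | _] =
    ~` [set t | `|cofactor (A t) i j| <= 0%:C * `|cofactor (A t) i j|] `&`
     [set t | `|\det (A t)| <= c%:C * `|cofactor (A t) i j|]).
  by apply: measurableI; [apply: measurableC|]; exact: measurable_normc_le.
rewrite /small_pivot ik jk; apply/seteqP; split => t /=; rewrite mul0r normr_le0.
  by move=> /andP[/negP].
by move=> [/negP cof0 detA]; rewrite cof0.
Qed.

(** Inverse of [minor_coordinates] on matrices with unit row and column sums; the corner is
    determined by the first row. *)
Definition complete_mx m (Y : 'M[R]_m) : 'M[R]_m.+1 :=
  \matrix_(i, j)
    match unlift ord0 i, unlift ord0 j with
    | Some a, Some b => Y a b
    | Some a, None => 1 - \sum_b Y a b
    | None, Some b => 1 - \sum_a Y a b
    | None, None => 1 - \sum_b (1 - \sum_a Y a b)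
    end.

Lemma minor_complete_mx m (Y : 'M[R]_m) : minor_coordinates (complete_mx Y) = Y.
Proof. by apply/matrixP => i j; rewrite !mxE !rshift1 !liftK. Qed.

Lemma complete_minor_mx m (X : 'M[R]_m.+1) :
  (forall i, \sum_j X i j = 1) -> (forall j, \sum_i X i j = 1) ->
  complete_mx (minor_coordinates X) = X.
Proof.
move=> rX cX.
have col b : 1 - \sum_a minor_coordinates X a b = X 0 (lift ord0 b).
  rewrite -(cX (lift ord0 b)) big_ord_recl -[RHS](addrK (\sum_a minor_coordinates X a b)).
  by congr (_ + _ - _); apply: eq_bigr => a _; rewrite !mxE !rshift1.
have row a : 1 - \sum_b minor_coordinates X a b = X (lift ord0 a) 0.
  rewrite -(rX (lift ord0 a)) big_ord_recl -[RHS](addrK (\sum_b minor_coordinates X a b)).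
  by congr (_ + _ - _); apply: eq_bigr => b _; rewrite !mxE !rshift1.
apply/matrixP => i j; rewrite mxE.
case: (unliftP ord0 i) => [a ->|->]; case: (unliftP ord0 j) => [b ->|->].
- by rewrite !mxE !rshift1.
- exact: row.
- exact: col.
- under eq_bigr do rewrite col.
  by rewrite -(rX 0) big_ord_recl addrK.
Qed.

Lemma complete_mx_row_sum m (Y : 'M[R]_m) i : \sum_j complete_mx Y i j = 1.
Proof.
rewrite big_ord_recl; under eq_bigr do rewrite mxE.
rewrite mxE unlift_none; case: (unlift ord0 i) => [a|];
  by under eq_bigr do rewrite liftK; rewrite subrK.
Qed.

Lemma complete_mx_col_sum m (Y : 'M[R]_m) j : \sum_i complete_mx Y i j = 1.
Proof.
rewrite big_ord_recl; under eq_bigr do rewrite mxE.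
rewrite mxE unlift_none; case: (unlift ord0 j) => [b|];
  under eq_bigr do rewrite liftK; first by rewrite subrK.
(* In column 0, the corner subtracts and the other entries add the same quantity, [m] minus the sum
   of all entries of [Y]. *)
rewrite !sumrB sumr_const card_ord exchange_big/=.
by rewrite subrK.
Qed.

(** This turns the image into a finite system of inequalities, from which its measurability
    follows. *)
Lemma minor_capped m : minor_coordinates @` @capped_doubly_stochastic R m.+1 =
  [set Y | forall i j,
     0 <= complete_mx Y i j <= 10 * ln m.+1%:R / m.+1%:R].
Proof.
apply/seteqP; split => Y /=.
  move=> [X [[X0 rX cX] Xc] <-] i j.
  by rewrite complete_minor_mx// X0 Xc.
move=> Yc; exists (complete_mx Y); last exact: minor_complete_mx.
split=> [|i j]; last by case/andP: (Yc i j).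
split=> [i j|i|j]; first by case/andP: (Yc i j).
  exact: complete_mx_row_sum.
exact: complete_mx_col_sum.
Qed.

Lemma measurable_complete_mx m i j :
  measurable_fun [set: (m * m).-tuple RT] (fun t => complete_mx (mx_of_tuple t) i j).
Proof.
under eq_fun do rewrite mxE.
have m1 (f : (m * m).-tuple RT -> R) : measurable_fun [set: (m * m).-tuple RT] f ->
    measurable_fun [set: (m * m).-tuple RT] (fun t => 1 - f t).
  by move=> mf; exact: measurable_funB.
case: (unlift ord0 i) => [a|]; case: (unlift ord0 j) => [b|].
- exact: measurable_mx_of_tuple.
- by apply: (m1 _ _); apply: measurable_sum => b; exact: measurable_mx_of_tuple.
- by apply: (m1 _ _); apply: measurable_sum => a; exact: measurable_mx_of_tuple.
- apply: (m1 _ _); apply: measurable_sum => b; apply: (m1 _ _).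
  by apply: measurable_sum => a; exact: measurable_mx_of_tuple.
Qed.

Lemma measurable_minor_capped m :
  measurable [set t : (m * m).-tuple RT |
    (minor_coordinates @` @capped_doubly_stochastic R m.+1) (mx_of_tuple t)].
Proof.
rewrite minor_capped.
rewrite (_ : [set t | _] = \bigcap_(p in [set: 'I_m.+1 * 'I_m.+1])
    ([set t | 0 <= complete_mx (mx_of_tuple t) p.1 p.2] `&`
     [set t | complete_mx (mx_of_tuple t) p.1 p.2 <= 10 * ln m.+1%:R / m.+1%:R])).
  apply: fin_bigcap_measurable => // p _.
  by apply: measurableI; apply: measurable_le_set => //; exact: measurable_complete_mx.
apply/seteqP; split => t /= h.
  by move=> [i j] _ /=; have /andP[] := h i j.
by move=> i j; apply/andP; exact: (h (i, j)).
Qed.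

End minor_space.

(** * The convex body of capped matrices and the union bound *)

Section capped_polytope.
Context {R : realType}.
Local Notation RT := (measurableTypeR R).

(** From [ln (1 + x) <= x] at [x = 1 / n - 1]. It ensures that the cap [10 ln n / n] leaves room
    above [1 / n]. *)
Lemma ln_natr_ge (n : nat) : (1 < n)%N -> 2^-1 <= ln n%:R :> R.
Proof.
move=> n1; have n0 : 0 < n%:R :> R by rewrite ltr0n ltnW.
have : ln (1 + (n%:R^-1 - 1)) <= n%:R^-1 - 1 :> R.
  by apply: le_ln1Dx; rewrite ltrBrDr addNr invr_gt0.
rewrite addrC subrK lnV ?posrE// => H.
have : n%:R^-1 <= 2^-1 :> R by rewrite lef_pV2 ?posrE// ler_nat.
move: H; lra.
Qed.

Lemma capped_doubly_stochastic_convex n (X Z : 'M[R]_n) (l : R) : 0 <= l <= 1 ->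
  capped_doubly_stochastic X -> capped_doubly_stochastic Z ->
  capped_doubly_stochastic ((1 - l) *: X + l *: Z).
Proof.
move=> /andP[l0 l1] [[X0 rX cX] Xc] [[Z0 rZ cZ] Zc].
have l0' : 0 <= 1 - l by rewrite subr_ge0.
split; first split=> [i j|i|j].
- by rewrite !mxE addr_ge0// mulr_ge0.
- under eq_bigr do rewrite !mxE.
  by rewrite big_split/= -!mulr_sumr rX rZ !mulr1 subrK.
- under eq_bigr do rewrite !mxE.
  by rewrite big_split/= -!mulr_sumr cX cZ !mulr1 subrK.
- move=> i j; rewrite !mxE.
  rewrite [leRHS](_ : _ = (1 - l) * (10 * ln n%:R / n%:R) + l * (10 * ln n%:R / n%:R)).
    by apply: lerD; apply: ler_wpM2l.
  by ring.
Qed.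

(** The matrix [J / n] moved by [s] along an exchange of mass between two rows and two columns; in
    the minor only coordinate (i, j) moves. *)
Definition exchange_mx m (i j : 'I_m) (s : R) : 'M[R]_m.+1 :=
  \matrix_(a, b) (m.+1%:R^-1 + s * (((a == lift ord0 i)%:R - (a == ord0)%:R)
                                    * ((b == lift ord0 j)%:R - (b == ord0)%:R))).

(** The perturbation has zero row and column sums and entries between [- s] and [s], so all entries
    lie between 0 and [2 / n], below the cap. *)
Lemma exchange_mx_capped m (i j : 'I_m) (s : R) : 0 <= s <= m.+1%:R^-1 ->
  capped_doubly_stochastic (exchange_mx i j s).
Proof.
move=> /andP[s0 sn].
have sum1 x : \sum_(a < m.+1) (a == x)%:R = 1 :> R.
  by rewrite (bigD1 x)//= eqxx big1 ?addr0// => a /negbTE ->.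
have sumV : \sum_(a < m.+1) m.+1%:R^-1 = 1 :> R.
  by rewrite sumr_const card_ord -[LHS]mulr_natl divff.
have ln2 : 2^-1 <= ln m.+1%:R :> R.
  by apply: ln_natr_ge; rewrite ltnS; exact: leq_ltn_trans (ltn_ord i).
have n0 : 0 < m.+1%:R^-1 :> R by rewrite invr_gt0.
have capn : 2 * m.+1%:R^-1 <= 10 * ln m.+1%:R / m.+1%:R :> R.
  by rewrite ler_pM2r//; lra.
have bound a b : - s <= s * (((a == lift ord0 i)%:R - (a == ord0)%:R)
    * ((b == lift ord0 j)%:R - (b == ord0)%:R)) <= s.
  do 4!case: (_ == _); rewrite ?(mulr1n, mulr0n, subrr, subr0, sub0r);
    by rewrite ?(mulrNN, mulr1, mulr0, mulrN1, mul0r, mulrN); lra.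
split; first split=> [a b|a|b].
- have /andP[+ _] := bound a b; rewrite mxE; set x := s * _ => sx.
  by rewrite -lerBlDr sub0r (le_trans _ sn)// lerNl.
- under eq_bigr do rewrite mxE.
  by rewrite big_split/= sumV -!mulr_sumr sumrB !sum1 subrr !mulr0 addr0.
- under eq_bigr do rewrite mxE mulrA.
  by rewrite big_split/= sumV -mulr_suml -mulr_sumr sumrB !sum1 subrr mulr0 mul0r addr0.
- move=> a b; apply: le_trans capn.
  have /andP[_ +] := bound a b; rewrite mxE; set x := s * _ => xs.
  by rewrite mulr_natl mulr2n lerD2l (le_trans xs).
Qed.

Lemma mxvec_index_eq m (a b i j : 'I_m) :
  (mxvec_index a b == mxvec_index i j) = ((a, b) == (i, j)).
Proof.
rewrite /mxvec_index (inj_eq (@cast_ord_inj _ _ _)).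
by rewrite (inj_eq enum_rank_inj).
Qed.

Local Notation capped m :=
  (minor_coordinates @` @capped_doubly_stochastic R m.+1).

Lemma measurable_capped_pivot m (z : R[i]) (c : R) k (i j : 'I_m) :
  measurable [set t : (m * m).-tuple RT |
    (capped m `&` [set Y | small_pivot c k i j (reduced_mx z Y)]) (mx_of_tuple t)].
Proof.
rewrite (_ : [set t | _] =
    [set t | capped m (mx_of_tuple t)] `&`
    [set t | small_pivot c k i j (reduced_mx z (mx_of_tuple t))])//.
apply: measurableI; first exact: measurable_minor_capped.
exact: measurable_small_pivot.
Qed.

Lemma lebesgue_small_pivot m (z : R[i]) (c : R) (N : nat)
    (p : 'I_m.+1 * 'I_m * 'I_m) :
  2 * (m * m)%:R * N%:R * (2 * c) < m.+1%:R^-1 ->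
  (N%:R%:E * lebesgue_mx (capped m `&`
      [set Y | small_pivot c p.1.1 p.1.2 p.2 (reduced_mx z Y)])
   <= 2%:E * lebesgue_mx (capped m))%E.
Proof.
case: p => -[k i] j /= Nc.
apply: (@lebesgue_thin_set _ _ _ _ (mxvec_index i j) (fun=> m.+1%:R^-1)
          m.+1%:R^-1 (2 * c) N) => //.
- exact: measurable_capped_pivot.
- by move=> t [].
(* The segment required by [lebesgue_thin_set] consists of the minors of [exchange_mx i j s];
   convexity keeps the contraction inside the body. *)
- move=> t s l [X Xc XY] l01 s01; exists ((1 - l) *: X + l *: exchange_mx i j s).
    exact/capped_doubly_stochastic_convex/exchange_mx_capped.
  apply/matrixP => a b; have /matrixP/(_ a b) := XY.
  rewrite !mxE tnth_mktuple !rshift1 => ->; congr (_ + _ * (_ + _)).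
  rewrite mxvec_index_eq xpair_eqE !(inj_eq lift_inj).
  rewrite ![lift _ _ == ord0]eq_sym !(negbTE (neq_lift _ _)) !subr0.
  by case: (a == i); case: (b == j); rewrite ?(mulr1, mul1r, mulr0, mul0r).
- move=> t u [_ /= pt] [_ /= pu] tu.
  rewrite -!mx_of_tupleE; apply: small_pivot_thin pt pu => a b ab.
  by rewrite -!/(mx_of_tuple _) !mx_of_tupleE tu// mxvec_index_eq.
Qed.

Lemma lebesgue_tuple_bigcup_le k (I : Type) (s : seq I) (F : I -> set (k.-tuple RT)) :
  (forall i, measurable (F i)) ->
  (lebesgue_tuple k (\big[setU/set0]_(i <- s) F i)
   <= \sum_(i <- s) lebesgue_tuple k (F i))%E.
Proof.
move=> mF; elim: s => [|i s IH]; first by rewrite !big_nil measure0.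
rewrite !big_cons; apply: le_trans (measureU2 _ _ _) _ => //.
  by apply: bigsetU_measurable.
exact: leeD2l.
Qed.

(** The left side equals [32 m^3 n^7 / n^17], so the claim follows from [32 n^11 < n^17], true since
    [32 < 2^6 <= n^6]. This accounts for the exponent 17. *)
Lemma small_pivot_scale m : (0 < m)%N ->
  2 * (m * m)%:R * (m.+1 ^ 6)%:R * (2 * (8 * m%:R * m.+1%:R * (m.+1%:R ^+ 17)^-1))
  < m.+1%:R^-1 :> R.
Proof.
move=> m0; set n := m.+1.
have n0 : n%:R != 0 :> R by rewrite pnatr_eq0.
rewrite (_ : _ * _ = (32 * m ^ 3 * n ^ 7)%:R / (n ^ 17)%:R); last first.
  by rewrite !(natrM, natrX); field.
rewrite ltr_pdivrMr ?ltr0n ?expn_gt0// mulrC ltr_pdivlMr ?ltr0n//.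
rewrite -natrM ltr_nat -mulnA -expnSr.
apply: (@leq_ltn_trans (32 * n ^ 11)).
  by rewrite -mulnA leq_mul2l (expnD n 3 8) leq_mul2r leq_exp2r// leqnSn orbT.
rewrite (expnD n 6 11) ltn_pmul2r ?expn_gt0//.
by apply: (@leq_trans (2 ^ 6)) => //; rewrite leq_exp2r.
Qed.

(** Union bound: there are [n m^2 <= n^3] sets [F p], each of proportion at most [2 / n^6]. *)
Lemma prob_small_singular_value m (z : R[i]) : (0 < m)%N ->
  0 <= prob_uniform_on (@capped_doubly_stochastic R m.+1)
    [set X | singular_value m.+1 (shifted_mx z X) <= (m.+1%:R ^+ 17)^-1]
  <= 2 * m.+1%:R ^- 3.
Proof.
move=> m0; set e := (_ ^+ 17)^-1; set E := [set X | _].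
rewrite /prob_uniform_on; set S := @capped_doubly_stochastic R m.+1.
pose c : R := 8 * m%:R * m.+1%:R * e.
pose F (p : 'I_m.+1 * 'I_m * 'I_m) : set 'M[R]_m :=
  capped m `&` [set Y | small_pivot c p.1.1 p.1.2 p.2 (reduced_mx z Y)].
have e0 : 0 <= e by rewrite invr_ge0 exprn_ge0.
have e4 : e <= (4 * m.+1%:R)^-1.
  rewrite lef_pV2 ?posrE ?exprn_gt0 ?mulr_gt0 ?ltr0n// -natrX -natrM ler_nat.
  rewrite expnSr leq_mul2r/=; apply: (@leq_trans (2 ^ 16)) => //.
  by rewrite leq_exp2r.
have EF : minor_coordinates @` (S `&` E) `<=` \big[setU/set0]_p F p.
  move=> _ [X [SX EX] <-]; have [[X0 rX cX] _] := SX.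
  have X01 i j : 0 <= X i j <= 1.
    by rewrite X0 -(rX i) (bigD1 j)//= lerDl sumr_ge0.
  have [|p Fp] := small_singular_value_pivot rX X01 _ EX; first by rewrite e0 e4.
  by rewrite -bigcup_seq; exists p => /=; rewrite ?mem_index_enum//; split=> //; exists X.
have muF p : ((m.+1 ^ 6)%:R%:E * lebesgue_mx (F p)
    <= 2%:E * lebesgue_mx (minor_coordinates @` S))%E.
  exact/lebesgue_small_pivot/small_pivot_scale.
set muE := lebesgue_mx _; set muK := lebesgue_mx _ in muF *.
have muE_le : ((m.+1 ^ 6)%:R%:E * muE <= (2 * m.+1%:R ^+ 3)%:E * muK)%E.
  apply: (@le_trans _ _ ((m.+1 ^ 6)%:R%:E * \sum_p lebesgue_mx (F p))%E).
    apply: lee_wpmul2l; first by rewrite lee_fin.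
    apply: le_trans (lebesgue_tuple_bigcup_le _ _); last first.
      by move=> p; exact: measurable_capped_pivot.
    (* The event enters only through its inclusion in the union of the measurable sets [F p]. *)
    apply: lebesgue_tuple_le => t /EF.
    by rewrite -!bigcup_seq => -[p ip Fp]; exists p.
  rewrite ge0_sume_distrr => [|p _]; last exact: measure_ge0.
  apply: (@le_trans _ _ (\sum_(p : 'I_m.+1 * 'I_m * 'I_m) 2%:E * muK)%E).
    by apply: lee_sum => p _; exact: muF.
  rewrite -ge0_sume_distrl; last by move=> p _; rewrite lee_fin.
  rewrite sumEFin sumr_const !card_prod !card_ord.
  apply: lee_wpmul2r; first exact: measure_ge0.
  rewrite lee_fin -[2 *+ _]mulr_natr ler_wpM2l// -natrX ler_nat.
  by rewrite !expnS expn0 muln1 mulnA !leq_mul.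
have muE0 : (0 <= muE)%E by exact: measure_ge0.
have muK0 : (0 <= muK)%E by exact: measure_ge0.
apply/andP; split; first by rewrite divr_ge0// fine_ge0.
(* This case covers a body of zero or infinite volume: [fine] is then 0, and so is the quotient. *)
have [->|] := eqVneq (fine muK) 0.
  by rewrite invr0 mulr0 mulr_ge0// invr_ge0 exprn_ge0.
case: muK muK0 muE_le {muF} => [k| |] //; last by rewrite /= eqxx.
rewrite lee_fin => k0 muE_le /= k_neq0.
have {k0 k_neq0} k0 : 0 < k by rewrite lt_neqAle eq_sym k_neq0.
(* An infinite [muE] would contradict [muE_le], whose right side is now finite. *)
case: muE muE0 muE_le => [x| |] //=; last first.
  by rewrite -EFinM gt0_muley ?lte_fin ?ltr0n ?expn_gt0// leye_eq.
rewrite !lee_fin natrX => x0 xk.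
rewrite ler_pdivrMr// -(@ler_pM2l _ (m.+1%:R ^+ 6)) ?exprn_gt0 ?ltr0n//.
apply: le_trans xk _; rewrite le_eqVlt; apply/orP; left; apply/eqP.
by field; rewrite addrC natr1 pnatr_eq0.
Qed.

End capped_polytope.

(* The size of the matrices is n = m.+1. *)
Theorem theorem5p2 (R : realType) (z0 : R[i]) :
  exists2 A : R, 0 < A &
    (fun m : nat =>
       prob_uniform_on (@capped_doubly_stochastic R m.+1)
         [set X | singular_value m.+1 (shifted_mx z0 X) <= m.+1%:R `^ (- A)]
       : R^o)
    =O_\oo (fun m : nat => m.+1%:R ^- 3 : R^o).
Proof.
(* Both constants come from [prob_small_singular_value], which applies as soon as [m > 0]. *)
exists 17%:R => //; apply/eqO_exP; exists 2 => //; near=> m.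
have m0 : (0 < m)%N by near: m; exact: nbhs_infty_gt.
rewrite powRN powR_mulrn//.
have /andP[p0 p_le] := prob_small_singular_value z0 m0.
by rewrite ger0_norm// ger0_norm// invr_ge0 exprn_ge0.
Unshelve. all: by end_near.
Qed.
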